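(* Let $X$ be a locally connected continuum. Suppose that $NC^{*}(X)$ is a closed subset of $C(X)$. Then $X$ is either an arc or a simple closed curve.
   Context: A continuum is a compact connected metric space with more than one point. A subcontinuum of $X$ is a nonempty closed connected subset of $X$ (one-point sets are allowed). $C(X)$ denotes the hyperspace of all subcontinua of $X$, endowed with the Hausdorff metric (equivalently, the Vietoris topology). $NC^{*}(X)=\{A\in C(X): X\setminus A \text{ is connected}\}$, with the subspace topology from $C(X)$. The empty set counts as connected, so $X\in NC^{*}(X)$. An arc is a space homeomorphic to $[0,1]$; a simple closed curve is a space homeomorphic to the unit circle in the plane. *)

(* Defs.v *)
From HB Require Import structures.
From mathcomp Require Import all_boot all_order all_algebra.
From mathcomp Require Import all_classical all_reals all_analysis.
Set Implicit Arguments. Unset Strict Implicit. Unset Printing Implicit Defensive.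
Import Order.TTheory GRing.Theory Num.Theory.
Import numFieldNormedType.Exports.
Local Open Scope classical_set_scope.
Local Open Scope ring_scope.

Section Defs.
Context {T : topologicalType}.

Definition locally_connected_space : Prop :=
  forall (x : T) (U : set T), open U -> U x ->
    exists V : set T, [/\ open V, connected V, V x & V `<=` U].

Definition subcontinuum (A : set T) : Prop :=
  [/\ A !=set0, closed A & connected A].

Definition NCstar (A : set T) : Prop :=
  subcontinuum A /\ connected (~` A).

Definition vietoris_basic (n : nat) (U : nat -> set T) (B : set T) : Prop :=
  B `<=` \bigcup_(i in [set i | (i < n)%N]) U i /\
  (forall i, (i < n)%N -> B `&` U i !=set0).

Definition vietoris_closure (P : set T -> Prop) (A : set T) : Prop :=
  forall (n : nat) (U : nat -> set T),
    (forall i, (i < n)%N -> open (U i)) ->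
    vietoris_basic n U A -> exists B, P B /\ vietoris_basic n U B.

Definition closed_in_CX (P : set T -> Prop) : Prop :=
  forall A, subcontinuum A -> vietoris_closure P A -> P A.

End Defs.

Definition is_arc {R : realType} (T : topologicalType) : Prop :=
  exists (f : R -> T) (g : T -> R),
    [/\ {within `[0, 1]%classic, continuous f}, continuous g,
        (forall x, g x \in `[0, 1]%R),
        (forall x, f (g x) = x) &
        (forall t, t \in `[0, 1]%R -> g (f t) = t)].

Definition unit_circle {R : realType} : set (R * R) :=
  [set p | p.1 ^+ 2 + p.2 ^+ 2 = 1].

Definition is_simple_closed_curve {R : realType} (T : topologicalType) : Prop :=
  exists (f : R * R -> T) (g : T -> R * R),
    [/\ {within (@unit_circle R), continuous f}, continuous g,
        (forall x, unit_circle (g x)),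
        (forall x, f (g x) = x) &
        (forall p, unit_circle p -> g (f p) = p)].

(* Main.v *)
Require Import Defs.
From HB Require Import structures.
From mathcomp Require Import all_boot all_order all_algebra.
From mathcomp Require Import all_classical all_reals all_analysis.
From mathcomp Require Import lra.
Set Implicit Arguments. Unset Strict Implicit. Unset Printing Implicit Defensive.
Import Order.TTheory GRing.Theory Num.Theory.
Import numFieldNormedType.Exports.
Local Open Scope classical_set_scope.
Local Open Scope ring_scope.

(** Write [side K q] for the component of the complement of [K] containing [q].
Closedness of [NCstar] keeps separation from arising in a limit: if each continuum [K] of
a directed family leaves [x] in [side K q], so does the closure of their union, because
the filled continua [~` side K q] lie in [NCstar].  Hence a connected open set whose
closure separates [q] from [x] contains a point separating [q] from [x].

Suppose that [X] has a cut point [c].  There are noncut points [p] and [q] on different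
sides of [c].  If a point separates [q] from two noncut points [p] and [x], choose such a
point [k] with [side [set k] q] maximal, which is possible because an increasing union of
such sides has a single boundary point.  Small connected open sets next to [k] and beyond
it still separate, and so does one of their points, contradicting maximality.  Therefore
[p] and [q] are the only noncut points, and every other point separates them.

Suppose that [X] has no cut point.  Then no continuum separates [X], so that any two
points [p] and [q] do: otherwise a continuum missing both could contain the boundary of a
neighborhood of [p].  Thus [X] is the union of two continua meeting in [p] and [q], and
each of their other points separates [p] from [q] within its continuum.

A continuum [A] with two ends separated by every other point is an arc: it is
parametrized by the sum over [n] of [2^-n * d (c n, init x)], where [init x] is the part
of [A] up to [x] and [c] is a dense sequence. *)

Section DirectedFamilies.
Context {I T : Type}.
Implicit Types (D : set I) (U : I -> set T).

Definition up_directed D U := forall i j, D i -> D j ->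
  exists2 k, D k & U i `|` U j `<=` U k.

Lemma up_directed_or D U (P Q : set T -> Prop) : up_directed D U ->
  (forall A B, A `<=` B -> P B -> P A) -> (forall A B, A `<=` B -> Q B -> Q A) ->
  (forall i, D i -> P (U i) \/ Q (U i)) ->
  (forall i, D i -> P (U i)) \/ (forall i, D i -> Q (U i)).
Proof.
move=> dU antiP antiQ PQ; apply: contrapT => /not_orP[].
move=> /existsNP[i /not_implyP[Di nPi]] /existsNP[j /not_implyP[Dj nQj]].
have [k Dk] := dU _ _ Di Dj; rewrite subUset => -[ik jk].
by have [/(antiP _ _ ik)|/(antiQ _ _ jk)] := PQ _ Dk.
Qed.

Lemma subset_maximal_exists D U : D !=set0 ->
  (forall F, F `<=` D -> F !=set0 -> up_directed F U ->
     exists2 m, D m & forall i, F i -> U i `<=` U m) ->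
  exists2 m, D m & forall i, D i -> U m `<=` U i -> U i `<=` U m.
Proof.
move=> [i0 Di0] boundD.
pose R (a b : {i | D i}) := `[< U (sval a) `<=` U (sval b) >].
have [|a b c /asboolP ab /asboolP bc|F totF|[m Dm] maxm] :=
  @ZL_preorder _ (exist _ i0 Di0) R.
- by move=> a; exact/asboolP.
- by apply/asboolP; exact: subset_trans bc.
- have [F0|F0] := pselect (F !=set0); last first.
    by exists (exist _ i0 Di0) => a Fa; exfalso; apply: F0; exists a.
  have [_ [a _ <-]|||m Dm boundm] := boundD (sval @` F).
  + exact: svalP.
  + by case: F0 => a Fa; exists (sval a); exists a.
  + move=> _ _ [a Fa <-] [b Fb <-].
    have [/asboolP ab|/asboolP ba] := totF _ _ Fa Fb.
      by exists (sval b); [exists b|rewrite subUset; split].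
    by exists (sval a); [exists a|rewrite subUset; split].
  + by exists (exist _ m Dm) => a Fa; apply/asboolP; apply: boundm; exists a.
exists m => // i Di mi; apply/asboolP.
by apply: (maxm (exist _ i Di)); exact/asboolP.
Qed.

End DirectedFamilies.

Section Connectedness.
Context {T : topologicalType}.
Implicit Types A B C O P Q : set T.

Lemma connected_sub_open C P Q : connected C -> open P -> open Q ->
  C `<=` P `|` Q -> C `&` P `&` Q = set0 -> C `&` P !=set0 -> C `<=` P.
Proof.
move=> cC oP oQ CPQ /disjoints_subset CPnQ CP.
suff <- : C `&` P = C by move=> x [].
apply: cC => //; first by exists P.
exists (~` Q); first exact: open_closedC.
apply/seteqP; split => x [Cx]; first by move=> Px; split => //; exact: CPnQ.
by move=> nQx; have [|/nQx] := CPQ _ Cx.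
Qed.

Lemma connected_sub_closed C P Q : connected C -> closed P -> closed Q ->
  C `<=` P `|` Q -> C `&` P `&` Q = set0 -> C `&` P !=set0 -> C `<=` P.
Proof.
move=> cC cP cQ CPQ CPQ0 [x [Cx Px]].
have CPnQ : C `&` P `<=` ~` Q by exact/disjoints_subset.
suff CnQ : C `<=` ~` Q by move=> y Cy; have [|/(CnQ _ Cy)] := CPQ _ Cy.
apply: (@connected_sub_open C (~` Q) (~` P)) => //.
- exact: closed_openC.
- exact: closed_openC.
- move=> y Cy; have [Py|] := pselect (P y); last by right.
  by left; exact: CPnQ.
- by rewrite -subset0 => y [[Cy nQy] nPy]; have [/nPy|/nQy] := CPQ _ Cy.
- by exists x; split => //; exact: CPnQ.
Qed.

Lemma connected_boundary C O : connected C -> open O -> C `&` O !=set0 ->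
  ~ C `<=` O -> C `&` (closure O `\` O) !=set0.
Proof.
move=> cC oO CO nCO; apply: contrapT => noboundary; apply: nCO.
apply: (@connected_sub_open C O (~` closure O)) => //.
- exact/closed_openC/closed_closure.
- move=> x Cx; have [clOx|] := pselect (closure O x); last by right.
  by left; apply: contrapT => nOx; apply: noboundary; exists x.
- by rewrite -subset0 => x [[_ Ox]]; apply; exact: subset_closure.
Qed.

Lemma connected_sub_closure A B : connected A -> A `<=` B -> B `<=` closure A ->
  connected B.
Proof.
move=> cA AB BclA; apply/connectedP => E [E0 BE [clE0 clE1]].
have AE : A `<=` E false `|` E true by rewrite -BE.
have [/closureS AE0|/closureS AE1] := connected_subset (conj clE0 clE1) AE cA.
  have [y Ey] := E0 true.
  have : (closure (E false) `&` E true) y.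
    by split => //; apply/AE0/BclA; rewrite BE; right.
  by rewrite clE0.
have [y Ey] := E0 false.
have : (E false `&` closure (E true)) y.
  by split => //; apply/AE1/BclA; rewrite BE; left.
by rewrite clE1.
Qed.

Lemma connected_adjoin A x : connected A -> closure A x -> connected (A `|` [set x]).
Proof.
move=> cA clAx; apply: (connected_sub_closure cA) => [y|y [/subset_closure//|->//]].
by left.
Qed.

Lemma up_directed_connected I (D : set I) (U : I -> set T) : up_directed D U ->
  (forall i, D i -> U i !=set0 /\ connected (U i)) -> connected (\bigcup_(i in D) U i).
Proof.
move=> dU cU; have [->|/set0P[i Di]] := eqVneq D set0.
  by rewrite bigcup_set0; exact: connected0.
have [[a Uia] _] := cU _ Di.
have -> : \bigcup_(j in D) U j = \bigcup_(j in [set j | D j /\ U j a]) U j.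
  apply/seteqP; split => x [j]; last by move=> [Dj _] Ujx; exists j.
  move=> Dj Ujx; have [k Dk] := dU _ _ Di Dj; rewrite subUset => -[ik jk].
  by exists k; [split => //; exact: ik|exact: jk].
apply: bigcup_connected; first by exists a => j [].
by move=> j [/cU[]].
Qed.

Lemma connected_componentS A B x : A `<=` B ->
  connected_component A x `<=` connected_component B x.
Proof.
move=> AB y [C [Cx CA cC Cy]]; exists C => //; split => //.
exact: subset_trans AB.
Qed.

Lemma connected_component_closure A x y : A y ->
  closure (connected_component A x) y -> connected_component A x y.
Proof.
move=> Ay clAy; have [Ax|nAx] := pselect (A x); last first.
  by move: clAy; rewrite connected_component_out// closure0.
exists (connected_component A x `|` [set y]); last by right.
split; first by left; exact: connected_component_refl.
  by move=> z [/connected_component_sub//|->].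
by apply: connected_adjoin => //; exact: component_connected.
Qed.

Lemma not_connected_components A : ~ connected A ->
  exists a b, [/\ A a, A b & ~ connected_component A a b].
Proof.
move=> nA; apply: contrapT => joined; apply: nA.
have [->|/set0P[a Aa]] := eqVneq A set0; first exact: connected0.
suff -> : A = connected_component A a by exact: component_connected.
apply/seteqP; split; last exact: connected_component_sub.
by move=> b Ab; apply: contrapT => nab; apply: joined; exists a, b.
Qed.

End Connectedness.

Section CompactHausdorff.
Context {X : topologicalType}.

Lemma compact_directed_cover I (D : set I) (U : I -> set X) H : compact H ->
  D !=set0 -> up_directed D U -> (forall i, D i -> open (U i)) ->
  H `<=` \bigcup_(i in D) U i -> exists2 i, D i & H `<=` U i.
Proof.
move=> cH D0 dU oU HU.
pose F := filter_from D (fun i => [set j | D j /\ U i `<=` U j]).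
have FF : Filter F.
  apply: filter_from_filter => // i j Di Dj.
  have [k Dk] := dU _ _ Di Dj; rewrite subUset => -[ik jk]; exists k => //.
  by move=> l [Dl kl]; split; split => //; exact: subset_trans kl.
have [|i Di Hi] := (compact_near_coveringP H).1 cH _ F U FF.
  move=> x /HU[i Di Uix]; exists (U i, [set j | D j /\ U i `<=` U j]).
    by split; [apply: open_nbhs_nbhs; split => //; exact: oU|exists i].
  by move=> [y j] [/= Uiy [_ /(_ _ Uiy)]].
by exists i => //; apply: Hi; split.
Qed.

Context (hX : hausdorff_space X) (cpt : compact [set: X]).
Implicit Types (A O : set X) (x : X).

Lemma closed_point x : closed [set x].
Proof. exact/accessible_closed_set1/hausdorff_accessible. Qed.

Lemma open_setC1 x : open (~` [set x]).
Proof. exact/closed_openC/closed_point. Qed.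

Lemma closed_sub_open A O : closed A -> open O -> A `<=` O ->
  exists G, [/\ open G, A `<=` G & closure G `<=` O].
Proof.
move=> cA oO AO; have AnO : set_nbhs A O by apply/set_nbhsP; exists O; split.
have [B AB BO] := compact_normal hX cpt cA AnO.
have /set_nbhsP[G [oG AG GB]] := AB; exists G; split => //.
by apply: subset_trans BO; exact: closureS.
Qed.

End CompactHausdorff.

Section Separation.
Context {T : topologicalType}.
Implicit Types (K L U : set T) (q x y : T).

Definition side K q := connected_component (~` K) q.

(* [side K q] is empty when [q] lies in [K], hence the first two conditions. *)
Definition separates K q x := [/\ ~ K q, ~ K x & ~ side K q x].

Definition cut_point x := ~ connected (~` [set x]).

Lemma side_subC K q : side K q `<=` ~` K.
Proof. exact: connected_component_sub. Qed.

Lemma side_anti K L q : K `<=` L -> side L q `<=` side K q.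
Proof. by move=> KL; apply: connected_componentS; exact: subsetC. Qed.

Lemma side_sub K L q : side K q `<=` ~` L -> side K q `<=` side L q.
Proof.
move=> sideL; have [Kq|nKq] := pselect (K q).
  by rewrite /side connected_component_out.
apply: connected_component_max => //; last exact: component_connected.
exact: connected_component_refl.
Qed.

Lemma closure_side K q : closure (side K q) `<=` side K q `|` K.
Proof.
move=> y clsy; have [Ky|nKy] := pselect (K y); first by right.
by left; exact: connected_component_closure.
Qed.

Lemma separatesC K q x : separates K q x -> separates K x q.
Proof. by move=> [nKq nKx nqx]; split => // /connected_component_sym. Qed.

Lemma separatesS K L q x : K `<=` L -> ~ L q -> ~ L x -> separates K q x ->
  separates L q x.
Proof. by move=> KL nLq nLx [_ _ nqx]; split => // /(side_anti KL). Qed.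

Lemma separates_neq K q x : separates K q x -> q <> x.
Proof.
by move=> [nKq _ + qx]; rewrite -qx; apply; exact: connected_component_refl.
Qed.

Lemma separates_side K q x y : separates K q x -> side K q y -> separates K y x.
Proof.
move=> [nKq nKx nqx] qy; split => //; first exact: side_subC qy.
by move=> yx; apply: nqx; exact: connected_component_trans qy yx.
Qed.

Lemma separates_cut_point x q y : separates [set x] q y -> cut_point x.
Proof.
move=> [xq xy nqy] noncut; apply: nqy.
by rewrite /side connected_component_id.
Qed.

Lemma not_connected_separates K : ~ connected (~` K) ->
  exists q x, separates K q x.
Proof.
by move=> /not_connected_components[q [x [nKq nKx nqx]]]; exists q, x.
Qed.

Lemma separates_point_boundary U b q x : open U -> closure U `<=` U `|` [set b] ->
  ~ U b -> U q -> ~ U x -> x <> b -> separates [set b] q x.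
Proof.
move=> oU clU nUb Uq nUx xb; have qb : q <> b by move=> qb; apply: nUb; rewrite -qb.
split => // qx.
have cside : connected (side [set b] q) by exact: component_connected.
have [||y [qy [clUy nUy]]] := connected_boundary cside oU.
- by exists q; split => //; exact: connected_component_refl.
- by move=> /(_ _ qx).
by have [//|yb] := clU _ clUy; exact: side_subC qy yb.
Qed.

End Separation.

Section LocallyConnected.
Context {X : topologicalType} (lc : @locally_connected_space X).
Implicit Types (C K O : set X) (x q : X).

Lemma open_component O x : open O -> open (connected_component O x).
Proof.
move=> oO; rewrite openE => y Oxy.
have Oy := connected_component_sub Oxy.
have [W [oW cW Wy WO]] := lc oO Oy.
apply: (filterS _ (open_nbhs_nbhs (conj oW Wy))) => z Wz.
by apply: (connected_component_trans Oxy); exists W.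
Qed.

Lemma open_side K q : closed K -> open (side K q).
Proof. by move=> cK; apply: open_component; exact: closed_openC. Qed.

Lemma component_boundary C O x : connected C -> open O -> C x -> O x -> ~ C `<=` O ->
  C `&` (closure (connected_component O x) `\` O) !=set0.
Proof.
move=> cC oO Cx Ox nCO.
have [||y [Cy [clOy nOy]]] := connected_boundary cC (@open_component O x oO).
- by exists x; split => //; exact: connected_component_refl.
- by move=> CO; apply: nCO; apply: subset_trans CO _; exact: connected_component_sub.
by exists y; split => //; split => // Oy; apply: nOy; exact: connected_component_closure.
Qed.

Context (conn : connected [set: X]).

Lemma connected_setC_side K q : closed K -> K !=set0 -> connected K -> ~ K q ->
  connected (~` side K q).
Proof.
move=> cK [k Kk] conK nKq.
have -> : ~` side K q = \bigcup_(y in ~` side K q) (K `|` side K y).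
  apply/seteqP; split => [y nqy|x [y nqy] [Kx|yx] qx].
  - exists y => //; have [Ky|nKy] := pselect (K y); first by left.
    by right; exact: connected_component_refl.
  - exact: side_subC qx Kx.
  - apply: nqy; apply: (connected_component_trans qx).
    exact: connected_component_sym.
apply: bigcup_connected => [|y _]; first by exists k => y _; left.
have [Ky|nKy] := pselect (K y).
  by rewrite /side connected_component_out// setU0.
have [|z [_ [clz /contrapT Kz]]] := component_boundary conn (closed_openC cK) I nKy.
  by move=> /(_ k I).
rewrite (_ : K `|` side K y = K `|` (side K y `|` [set z])); last first.
  by rewrite setUA setUAC (@setUidPl _ K [set z]).2 => [|_ ->].
apply: connectedU => //; first by exists z; split => //; right.
by apply: connected_adjoin => //; exact: component_connected.
Qed.

End LocallyConnected.

Section LocallyConnectedContinuum.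
Context {X : topologicalType} (hX : hausdorff_space X) (cpt : compact [set: X]).
Context (lc : @locally_connected_space X).
Implicit Types (A C H K L M N O U V W : set X) (x y q k : X).

Lemma connected_open_nbhs x O : open O -> O x ->
  exists V, [/\ open V, connected V, V x & closure V `<=` O].
Proof.
move=> oO Ox.
have [_ -> //|G [oG xG GO]] := closed_sub_open hX cpt (closed_point hX (x:=x)) oO.
have [V [oV cV Vx VG]] := lc oG (xG _ erefl); exists V; split => //.
by apply: subset_trans GO; exact: closureS.
Qed.

Lemma connected_open_between H V : closed H -> open V -> connected V -> V !=set0 ->
  H `<=` V -> exists W, [/\ open W, connected W, H `<=` W & closure W `<=` V].
Proof.
move=> cH oV cV [v Vv] HV.
pose F := [set W | [/\ open W, connected W, W v & closure W `<=` V]].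
have FU W W' : F W -> open W' -> connected W' -> W `&` W' !=set0 ->
    closure W' `<=` V -> F (W `|` W').
  move=> [oW cW Wv clW] oW' cW' WW' clW'; split;
    [exact: openU|exact: connectedU|by left|by rewrite closureU subUset].
have F0 : F !=set0.
  by have [W [oW cW Wv clW]] := connected_open_nbhs oV Vv; exists W.
have oF : open (\bigcup_(W in F) W) by apply: bigcup_open => W [].
have VF : V `<=` \bigcup_(W in F) W.
  apply: contrapT => nVF.
  have [|y [Vy [clFy nFy]]] := connected_boundary cV oF _ nVF.
    by exists v; split => //; case: F0 => W FW; exists W => //; case: FW.
  have [N [oN cN Ny clN]] := connected_open_nbhs oV Vy.
  have [z [[W FW Wz] Nz]] := clFy N (open_nbhs_nbhs (conj oN Ny)).
  apply: nFy; exists (W `|` N); last by right.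
  by apply: FU => //; exists z.
have [W W' FW FW'|W []||W [oW cW Wv clW] HW] :=
    compact_directed_cover (U := id) (subclosed_compact cH cpt (@subsetT _ H)) F0.
- exists (W `|` W') => //; have [oW' cW' W'v clW'] := FW'.
  by apply: FU => //; exists v; split => //; case: FW.
- by [].
- exact: subset_trans HV VF.
by exists W.
Qed.

Lemma subcontinuum_open_nbhs K O : subcontinuum K -> open O -> K `<=` O ->
  exists V, [/\ open V, connected V, K `<=` V & closure V `<=` O].
Proof.
move=> [[k Kk] cK conK] oO KO.
have [||||V [oV cV KV clV]] := @connected_open_between K (connected_component O k) cK.
- exact: open_component.
- exact: component_connected.
- by exists k; exact/connected_component_refl/KO.
- exact: connected_component_max.
exists V; split => //; apply: subset_trans clV _; exact: connected_component_sub.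
Qed.

Lemma side_stable K q x : closed K -> side K q x ->
  exists O, [/\ open O, K `<=` O & forall L, L `<=` O -> side L q x].
Proof.
move=> cK qx.
have qq : side K q q.
  apply: connected_component_refl => Kq.
  by move: qx; rewrite /side connected_component_out.
have [|||||W [oW cW qxW clW]] := @connected_open_between ([set q] `|` [set x]) (side K q).
- by apply: closedU; exact: closed_point.
- exact: open_side.
- exact: component_connected.
- by exists q.
- by move=> _ [] ->.
exists (~` closure W); split; first exact/closed_openC/closed_closure.
  by apply: subsetCr => y /clW; exact: side_subC.
move=> L LW; exists W; last by apply: qxW; right.
split => //; first by apply: qxW; left.
by apply: subsetCr; apply: subset_trans LW _; apply: subsetC; exact: subset_closure.
Qed.

Lemma subcontinuum_closure A : A !=set0 -> connected A -> subcontinuum (closure A).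
Proof.
move=> [a Aa] cA; split; first by exists a; exact: subset_closure.
  exact: closed_closure.
exact: connected_closure.
Qed.

Lemma subcontinuum_growth M G V : subcontinuum M -> open G -> M `<=` G -> open V ->
  connected V -> M `&` V !=set0 -> ~ V `<=` M ->
  exists N, [/\ subcontinuum N, M `<=` N, N `<=` G, N `<=` M `|` V & ~ N `<=` M].
Proof.
move=> [M0 cM conM] oG MG oV cV [v [Mv Vv]] nVM.
have [||z [Vz [clz /contrapT Mz]]] := connected_boundary cV (closed_openC cM).
- apply: contrapT => VM0; apply: nVM => y Vy; apply: contrapT => nMy.
  by apply: VM0; exists y.
- by move=> /(_ v Vv).
have [|W [oW cW Wz clW]] := @connected_open_nbhs z (G `&` V) (openI oG oV).
  by split => //; exact: MG.
have [y [nMy Wy]] := clz W (open_nbhs_nbhs (conj oW Wz)).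
exists (M `|` closure W); split.
- split; first by exists v; left.
    by apply: closedU => //; exact: closed_closure.
  apply: connectedU => //; last exact: connected_closure.
  by exists z; split => //; exact: subset_closure.
- by move=> w; left.
- by move=> w [/MG|/clW[]].
- by move=> w [|/clW[]]; [left|right].
- by move=> /(_ y (or_intror (subset_closure Wy))).
Qed.

Section ClosedNCstar.
Context (conn : connected [set: X]) (hcl : closed_in_CX (@NCstar X)).

Lemma NCstar_setC_side q K : subcontinuum K -> ~ K q -> NCstar (~` side K q).
Proof.
move=> [[k Kk] cK conK] nKq; split; last by rewrite setCK; exact: component_connected.
split; [by exists k => /side_subC|by apply: open_closedC; exact: open_side|].
by apply: connected_setC_side => //; exists k.
Qed.

Lemma NCstar_closure_bigcup I (D : set I) (U : I -> set X) : D !=set0 ->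
  up_directed D U -> (forall i, D i -> NCstar (U i)) ->
  NCstar (closure (\bigcup_(i in D) U i)).
Proof.
move=> [i0 Di0] dU UN; apply: hcl.
  have [[[a Ua] _ _] _] := UN _ Di0.
  apply: subcontinuum_closure; first by exists a; exists i0.
  by apply: up_directed_connected => // i /UN[[]].
move=> n O oO [UO OU].
suff [i Di iO] : exists2 i, D i & forall m, (m < n)%N -> U i `&` O m !=set0.
  exists (U i); split; first exact: UN.
  split => //; apply: subset_trans UO => x Ux.
  by apply: subset_closure; exists i.
have : (n <= n)%N by [].
elim: {1 3}n => [|m IH] mn; first by exists i0.
have [i Di iO] := IH (ltnW mn).
have [x [clx Ox]] := OU m mn.
have [y [[j Dj Ujy] Oy]] := clx _ (open_nbhs_nbhs (conj (oO _ mn) Ox)).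
have [k Dk] := dU _ _ Di Dj; rewrite subUset => -[ik jk].
exists k => // l; rewrite ltnS leq_eqVlt => /orP[/eqP ->|lm].
  by exists y; split => //; exact: jk.
by have [z [Uz Oz]] := iO _ lm; exists z; split => //; exact: ik.
Qed.

Lemma side_closure_bigcup (F : set (set X)) q x : F !=set0 -> up_directed F id ->
  F `<=` subcontinuum -> ~ closure (\bigcup_(K in F) K) q ->
  ~ closure (\bigcup_(K in F) K) x -> (forall K, F K -> side K q x) ->
  side (closure (\bigcup_(K in F) K)) q x.
Proof.
set Z := closure _ => F0 dF FS nZq nZx Fqx.
have FZ K : F K -> K `<=` Z by move=> FK y Ky; apply: subset_closure; exists K.
have oZ p : open (side Z p) by apply: open_side => //; exact: closed_closure.
pose B := closure (\bigcup_(K in F) ~` side K q).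
have [_ connB] : NCstar B.
  apply: NCstar_closure_bigcup => // [K L FK FL|K FK].
    have [M FM] := dF _ _ FK FL; rewrite subUset => -[KM LM].
    by exists M => //; rewrite subUset; split; apply: subsetC; exact: side_anti.
  by apply: NCstar_setC_side; [exact: FS|move=> /(FZ _ FK)].
have notB p : ~ Z p -> (forall K, F K -> side K q p) -> ~ B p.
  move=> nZp qp Bp.
  have [|y [[K FK nqy] py]] := Bp (side Z p).
    by apply: open_nbhs_nbhs; split => //; exact: connected_component_refl.
  apply: nqy; apply: (connected_component_trans (qp _ FK)).
  exact: (side_anti (FZ _ FK)) py.
exists (~` B); last exact: notB.
split => //.
  by apply: notB => // K FK; apply: connected_component_refl => /(FZ _ FK).
by apply: subsetC; apply: closureS => y [K FK Ky]; exists K => // /side_subC.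
Qed.

Definition joins_either q x y K := side K q x \/ side K q y.

Lemma joins_either_closure_bigcup (F : set (set X)) q x y : F !=set0 ->
  up_directed F id -> F `<=` subcontinuum ->
  ~ closure (\bigcup_(K in F) K) q -> ~ closure (\bigcup_(K in F) K) x ->
  ~ closure (\bigcup_(K in F) K) y -> F `<=` joins_either q x y ->
  joins_either q x y (closure (\bigcup_(K in F) K)).
Proof.
move=> F0 dF FS nq nx ny Fj.
have [K L||K|qx|qy] := up_directed_or (P := fun K => side K q x)
  (Q := fun K => side K q y) dF.
- by move=> KL; exact: side_anti.
- by move=> K L KL; exact: side_anti.
- exact: Fj.
- by left; exact: side_closure_bigcup.
- by right; exact: side_closure_bigcup.
Qed.

Lemma maximal_joining_subcontinuum Z v q x y : closed Z -> Z v ->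
  ~ Z q -> ~ Z x -> ~ Z y -> joins_either q x y [set v] ->
  exists M, [/\ subcontinuum M, M v, M `<=` Z, joins_either q x y M &
    forall N, subcontinuum N -> M `<=` N -> N `<=` Z -> joins_either q x y N ->
      N `<=` M].
Proof.
move=> cZ Zv nZq nZx nZy jv.
pose P := [set M | [/\ subcontinuum M, M v, M `<=` Z & joins_either q x y M]].
have [|F FP [A FA] dF|M [sM Mv MZ jM] maxM] := @subset_maximal_exists _ _ P id.
- exists [set v]; split => //; last by move=> _ ->.
  by split; [exists v|exact: closed_point|exact: connected1].
- have FS : F `<=` subcontinuum by move=> B /FP[].
  set U := \bigcup_(K in F) K.
  have FU B : F B -> B `<=` closure U.
    by move=> FB z Bz; apply: subset_closure; exists B.
  have UZ : closure U `<=` Z.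
    by rewrite [Z](closure_id _).1//; apply: closureS => z [B /FP[_ _ + _]]; exact.
  have Uv : closure U v by apply: (FU _ FA); have [] := FP _ FA.
  exists (closure U) => //; split => //.
    apply: subcontinuum_closure; first by exists v; exists A => //; have [] := FP _ FA.
    by apply: up_directed_connected => // B /FS[].
  apply: joins_either_closure_bigcup => //; [by exists A|by move=> /UZ
    |by move=> /UZ|by move=> /UZ|by move=> B /FP[]].
exists M; split => // N sN MN NZ jN.
by apply: maxM => //; split => //; exact: MN.
Qed.

(* If no point of [V] separates, a maximal continuum in [closure V] joining [q] to [x]
   or to [y] grows into [V] until it contains [closure V]. *)
Lemma open_separating_point V q x y : open V -> connected V -> V !=set0 ->
  separates (closure V) q x -> separates (closure V) q y ->
  exists k, [/\ V k, separates [set k] q x & separates [set k] q y].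
Proof.
move=> oV cV [v Vv] [nVq nVx nqx] [_ nVy nqy]; apply: contrapT => nosep.
have clVv : closure V v by exact: subset_closure.
have [|M [sM Mv MV jM maxM]] := maximal_joining_subcontinuum
    (@closed_closure _ V) clVv nVq nVx nVy.
  apply: contrapT => /not_orP[nvx nvy]; apply: nosep.
  by exists v; split => //; split => // vE;
    [apply: nVq|apply: nVx|apply: nVq|apply: nVy]; rewrite vE.
have [_ cM _] := sM.
have nVM : ~ V `<=` M.
  move=> /closureS; rewrite -[closure M](closure_id _).1// => clVM.
  by case: jM => /(side_anti clVM).
have [G [oG MG jG]] : exists G,
    [/\ open G, M `<=` G & forall L, L `<=` G -> joins_either q x y L].
  by case: jM => /(side_stable cM)[G [oG MG sideG]]; exists G; split => // L /sideG;
    [left|right].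
have [|N [sN MN NG NMV nNM]] := subcontinuum_growth sM oG MG oV cV _ nVM.
  by exists v.
apply/nNM/maxM => //; last exact: jG.
by move=> z /NMV[/MV//|]; exact: subset_closure.
Qed.

End ClosedNCstar.
End LocallyConnectedContinuum.

Section CutArcs.
Context {T : topologicalType}.
Implicit Types (A D E : set T) (p q x : T).

Definition cuts_at A p q x D E :=
  [/\ closed D, closed E, A = D `|` E, D `&` E = [set x] & D p /\ E q].

Definition cut_arc A p q :=
  [/\ [/\ p <> q, A p & A q], closed A, connected A &
      forall x, A x -> x <> p -> x <> q -> exists D E, cuts_at A p q x D E].

End CutArcs.

Section CutPoints.
Context {X : topologicalType} (hX : hausdorff_space X) (cpt : compact [set: X]).
Context (conn : connected [set: X]) (lc : @locally_connected_space X).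
Implicit Types (F U V : set X) (b c k l p q x y z : X).

Notation side1 k := (side [set k]).

Lemma open_side1 k q : open (side1 k q).
Proof. by apply: open_side => //; exact: closed_point. Qed.

Lemma closure_side1 k q : q <> k -> closure (side1 k q) k.
Proof.
move=> qk; have oCk := open_setC1 hX k.
have [|z [_ [+ /contrapT zk]]] := component_boundary lc conn oCk I qk.
  by move=> /(_ k I); apply.
by rewrite zk.
Qed.

Lemma side1_subset_side1 k l q : ~ side1 k q l -> side1 k q `<=` side1 l q.
Proof. by move=> nkl; apply: side_sub => y ky /= yl; apply: nkl; rewrite -yl. Qed.

Lemma side1_proper k l q : q <> k -> k <> l -> ~ side1 k q l ->
  ~ side1 l q `<=` side1 k q.
Proof.
move=> qk kl nkl lk; have [|//] : (side1 l q `|` [set l]) k.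
  by apply: closure_side; apply: closureS (closure_side1 qk); exact: side1_subset_side1.
by move=> /lk/side_subC; apply.
Qed.

Lemma noncut_point_exists q z : z <> q ->
  exists2 w, ~ side1 z q w & ~ cut_point w.
Proof.
move=> zq; have neq w : ~ side1 z q w -> q <> w.
  by move=> nw qw; apply: nw; rewrite -qw; apply: connected_component_refl => /esym.
have [|F FP F0 dF|m nzm maxm] :=
    @subset_maximal_exists _ _ [set w | ~ side1 z q w] (fun w => side1 w q).
- by exists z => /side_subC; apply.
- have [w nFw] : exists w, ~ (\bigcup_(k in F) side1 k q) w.
    apply: contrapT => /forallNP FT.
    have [k _||k Fk kT] := compact_directed_cover cpt F0 dF.
    + exact: open_side1.
    + by move=> w _; apply: contrapT; exact: FT.
    + by have /side_subC := kT k I; apply.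
  have Fw k : F k -> side1 k q `<=` side1 w q.
    by move=> Fk; apply: side1_subset_side1 => kw; apply: nFw; exists k.
  exists w => // zw; have [k Fk] := F0.
  by apply: nFw; exists k => //; apply: side1_subset_side1 zw; exact: FP.
exists m => //; apply; suff -> : ~` [set m] = side1 m q by exact: component_connected.
apply/seteqP; split; last exact: side_subC.
move=> y ym; apply: contrapT => nmy.
have zy : ~ side1 z q y by move=> /(side1_subset_side1 nzm).
have my := side1_subset_side1 nmy.
apply: (side1_proper (neq _ nzm) _ nmy); last exact: maxm.
by move=> /esym.
Qed.

Lemma directed_side1_boundary_unique F q b b' (U := \bigcup_(k in F) side1 k q) :
  up_directed F (fun k => side1 k q) ->
  closure U b -> ~ U b -> closure U b' -> ~ U b' -> b = b'.
Proof.
move=> dF clb nUb clb' nUb'; apply: hX => N N' nN nN'.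
have [W [oW cW Wb WN]] := lc (@open_interior _ N) nN.
have [W' [oW' cW' Wb' WN']] := lc (@open_interior _ N') nN'.
have [z [[k Fk kz] Wz]] := clb W (open_nbhs_nbhs (conj oW Wb)).
have [z' [[k' Fk' kz'] Wz']] := clb' W' (open_nbhs_nbhs (conj oW' Wb')).
have [l Fl] := dF _ _ Fk Fk'; rewrite subUset => -[kl k'l].
have mem_l V w v : connected V -> V w -> side1 l q w -> V v -> ~ U v -> V l.
  move=> cV Vw lw Vv nUv.
  have [||y [Vy [cly nly]]] := connected_boundary cV (open_side1 l q).
  - by exists w.
  - by move=> Vl; apply: nUv; exists l => //; exact: Vl.
  by have [/nly//|<-] := closure_side cly.
exists l; split; apply: interior_subset.
- exact/WN/(mem_l _ _ _ cW Wz (kl _ kz) Wb nUb).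
- exact/WN'/(mem_l _ _ _ cW' Wz' (k'l _ kz') Wb' nUb').
Qed.

Lemma directed_separating_limit F q p x : p <> x -> ~ cut_point p -> ~ cut_point x ->
  F !=set0 -> up_directed F (fun k => side1 k q) ->
  (forall k, F k -> separates [set k] q p /\ separates [set k] q x) ->
  exists b, [/\ separates [set b] q p, separates [set b] q x &
    forall k, F k -> side1 k q `<=` side1 b q].
Proof.
move=> px ncp ncx [k0 Fk0] dF sepF; set U := \bigcup_(k in F) side1 k q.
have oU : open U by apply: bigcup_open => k _; exact: open_side1.
have Uq : U q.
  by exists k0 => //; apply: connected_component_refl; case: (sepF _ Fk0) => -[].
have nUp : ~ U p by move=> [k /sepF[[]]].
have nUx : ~ U x by move=> [k /sepF[_ []]].
have [||b [_ [clb nUb]]] := connected_boundary conn oU.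
- by exists q.
- by move=> /(_ p I).
have clU : closure U `<=` U `|` [set b].
  move=> y cly; have [|nUy] := pselect (U y); first by left.
  by right; exact: (directed_side1_boundary_unique dF).
have sep y : ~ U y -> y <> b -> separates [set b] q y.
  exact: separates_point_boundary.
have pb : p <> b.
  by move=> pb; apply/ncp/(@separates_cut_point _ _ q x); rewrite pb; apply: sep;
    rewrite -?pb // => /esym.
have xb : x <> b.
  by move=> xb; apply/ncx/(@separates_cut_point _ _ q p); rewrite xb; apply: sep;
    rewrite -?xb.
exists b; split; [exact: sep|exact: sep|] => k Fk.
by apply: side1_subset_side1 => kb; apply: nUb; exists k.
Qed.

Lemma connected_open_adherent U N k : open U -> ~ U k -> closure U k ->
  closure U `<=` U `|` [set k] -> open N -> N k ->
  exists W, [/\ open W, connected W, W !=set0, W `<=` U &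
    closure W k /\ closure W `<=` N].
Proof.
move=> oU nUk clUk clU oN Nk.
have [V [oV cV Vk clV]] := connected_open_nbhs hX cpt lc oN Nk.
have [w [Uw Vw]] := clUk _ (open_nbhs_nbhs (conj oV Vk)).
have sub : connected_component (V `&` U) w `<=` V `&` U := @connected_component_sub _ _ _.
exists (connected_component (V `&` U) w); split.
- by apply: open_component => //; exact: openI.
- exact: component_connected.
- by exists w; exact: connected_component_refl.
- by move=> z /sub[].
split; last by apply: subset_trans clV; apply: closureS => z /sub[].
have [|z [Vz [clz nVUz]]] := component_boundary lc cV (openI oV oU) Vw (conj Vw Uw).
  by move=> /(_ _ Vk)[].
have [Uz|<-//] : (U `|` [set k]) z by apply: clU; apply: closureS clz => v /sub[].
by exfalso; apply: nVUz.
Qed.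

Lemma closure_setC_closure_side1 k q (U := ~` closure (side1 k q)) : U !=set0 ->
  closure U k /\ closure U `<=` U `|` [set k].
Proof.
move=> [x Ux]; have clU : closure U `<=` U `|` [set k].
  move=> z clz; have [|/contrapT/closure_side[kz|->]] := pselect (U z).
  - by left.
  - have [w [nclw kw]] := clz _ (open_nbhs_nbhs (conj (open_side1 k q) kz)).
    by exfalso; apply/nclw/subset_closure.
  - by right.
split => //; have [|nUk] := pselect (U k); first exact: subset_closure.
have [|||z [_ [clz nUz]]] := connected_boundary conn (O := U).
- exact/closed_openC/closed_closure.
- by exists x.
- by move=> /(_ k I).
by have [//|<-] := clU _ clz.
Qed.

Context (hcl : closed_in_CX (@NCstar X)).

Lemma separating_point_beyond k q x y :
  separates [set k] q x -> separates [set k] q y ->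
  exists l, [/\ l <> k, ~ side1 k q l, separates [set l] q x & separates [set l] q y].
Proof.
move=> kqx kqy; have [qk xk nqx] := kqx; have [_ yk nqy] := kqy.
have clk := closure_side1 qk.
have [|clUk clU] := @closure_setC_closure_side1 k q.
  by exists x => /closure_side[].
have [||||W [oW cW W0 WU [clWk clW]]] := connected_open_adherent (N :=
    ~` [set q] `&` ~` [set x] `&` ~` [set y]) _ _ clUk clU.
- exact/closed_openC/closed_closure.
- by apply.
- by apply: openI; [apply: openI|]; exact: open_setC1.
- by split; [split|]; exact: nesym.
have kW : [set k] `<=` closure W by move=> _ ->.
have [||l [Wl lqx lqy]] :=
  open_separating_point hX cpt lc conn hcl oW cW W0 (q := q) (x := x) (y := y).
- by apply: separatesS kW _ _ kqx => /clW[[nq nx] _]; [apply: nq|apply: nx].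
- by apply: separatesS kW _ _ kqy => /clW[[nq _] ny]; [apply: nq|apply: ny].
have nclWl := WU _ Wl.
by exists l; split => // [lk|kl]; apply: nclWl; [rewrite lk|exact: subset_closure].
Qed.

Lemma noncut_unique_beyond c q p x : separates [set c] q p -> separates [set c] q x ->
  ~ cut_point p -> ~ cut_point x -> p = x.
Proof.
move=> cp cx ncp ncx; apply: contrapT => px.
have [|F FP F0 dF|k [kp kx] maxk] := @subset_maximal_exists _ _
    [set k | separates [set k] q p /\ separates [set k] q x] (fun k => side1 k q).
- by exists c.
- by have [b []] := directed_separating_limit px ncp ncx F0 dF FP; exists b.
have [l [lk nkl lp lx]] := separating_point_beyond kp kx.
apply: (side1_proper _ _ nkl); [by case: kp|by move=> /esym|].
by apply: maxk => //; exact: side1_subset_side1.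
Qed.

Lemma cut_point_cut_arc c : cut_point c -> exists p q, cut_arc [set: X] p q.
Proof.
move=> /[dup] cutc /not_connected_separates[a [b [ac bc nab]]].
have neq z w : cut_point z -> ~ cut_point w -> z <> w by move=> + + zw; rewrite zw.
have [p nap ncp] : exists2 w, ~ side1 c a w & ~ cut_point w.
  by apply: noncut_point_exists => /esym.
have [q npq ncq] := noncut_point_exists (neq _ _ cutc ncp).
have sepc w : ~ cut_point w -> w <> c by move=> /(neq _ _ cutc) + /esym; apply.
have cpq : separates [set c] p q by split => //; exact: sepc.
have noncut2 z : ~ cut_point z -> z = p \/ z = q.
  move=> ncz; have [qz|nqz] := pselect (side1 c q z).
    right; apply: (@noncut_unique_beyond c p) => //.
    exact/separatesC/(separates_side (separatesC cpq)).
  left; apply: (@noncut_unique_beyond c q) => //; last exact: separatesC.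
  by split => //; exact: sepc.
exists p, q; split => // [|z _ zp zq].
  by split => //; exact: separates_neq cpq.
have [w npw ncw] := noncut_point_exists zp.
have nzpq : ~ side1 z p q.
  have [wp|<-//] := noncut2 _ ncw.
  by exfalso; apply: npw; rewrite wp; apply: connected_component_refl => /esym.
exists (closure (side1 z p)), (~` side1 z p); split.
- exact: closed_closure.
- by apply: open_closedC; exact: open_side1.
- apply/seteqP; split => // y _; have [py|] := pselect (side1 z p y); last by right.
  by left; exact: subset_closure.
- apply/seteqP; split => y; first by move=> [/closure_side[//|]].
  by move=> ->; split; [apply: closure_side1 => /esym|move=> /side_subC; apply].
- by split=> //; apply/subset_closure/connected_component_refl => /esym.
Qed.

End CutPoints.

Section NoCutPoint.
Context {X : topologicalType} (hX : hausdorff_space X) (cpt : compact [set: X]).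
Context (conn : connected [set: X]) (lc : @locally_connected_space X).
Context (hcl : closed_in_CX (@NCstar X)) (noncut : forall x : X, ~ cut_point x).
Implicit Types (G H K U V : set X) (p q u v x y z : X).

Lemma noncut_subcontinuum_connectedC K : subcontinuum K -> connected (~` K).
Proof.
move=> sK; apply: contrapT => /not_connected_separates[a [b Kab]].
have [[k Kk] _ _] := sK; have [nKa nKb _] := Kab.
have [||V [oV cV KV clV]] := subcontinuum_open_nbhs hX cpt lc sK
    (O := ~` [set a] `&` ~` [set b]).
- by apply: openI; exact: open_setC1.
- by move=> y Ky; split => yE; [apply: nKa|apply: nKb]; rewrite -yE.
have Vab : separates (closure V) a b.
  apply: separatesS Kab => [y /KV|/clV[+ _]|/clV[_ +]]; [exact: subset_closure| |];
    exact.
have [|c [_ cab _]] := open_separating_point hX cpt lc conn hcl oV cV _ Vab Vab.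
  by exists k; exact: KV.
exact: noncut (separates_cut_point cab).
Qed.

Lemma noncut_not_connected_setC2 p q : p <> q -> ~ connected (~` [set p; q]).
Proof.
move=> pq cpq; have [|_ -> qp|G [oG pG clG]] :=
    closed_sub_open hX cpt (closed_point hX (x := p)) (O := ~` [set q]).
- exact: open_setC1.
- exact: pq.
have Gp : G p := pG _ erefl.
have nclGq : ~ closure G q by move=> /clG; apply.
have [||h [_ Gh]] := connected_boundary conn oG; first by exists p.
  by move=> /(_ q I)/subset_closure.
have sub : closure G `\` G `<=` ~` [set p; q].
  by move=> y [clGy nGy] [yp|yq]; [apply: nGy; rewrite yp|apply: nclGq; rewrite -yq].
have [|||W [oW cW GW clW]] := connected_open_between hX cpt lc _ _ cpq _ sub.
- by apply: closedI; [exact: closed_closure|exact: open_closedC].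
- by apply/closed_openC/closedU; exact: closed_point.
- by exists h; exact: sub.
have : connected (~` closure W).
  by apply/noncut_subcontinuum_connectedC/subcontinuum_closure => //; exists h; exact: GW.
move=> /connected_boundary/(_ oG)[||y [nclWy /GW/subset_closure//]].
- by exists p; split => // /clW; apply; left.
- by move=> /(_ q)/= Gq; apply: nclGq; apply/subset_closure/Gq => /clW; apply; right.
Qed.

Lemma closure_pair_boundary p q U : p <> q -> open U -> U !=set0 ->
  U `<=` ~` [set p; q] -> closure U `<=` U `|` [set p; q] ->
  closure U = U `|` [set p; q].
Proof.
move=> pq oU [u Uu] Upq clU; apply/seteqP; split => // y [/subset_closure//|].
wlog -> : p q pq Upq clU / y = p => [wl [yp|yq]|_].
- by apply: (wl p q) => //; left.
- apply: (wl q p) => //; [exact: nesym| | |by left];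
    by rewrite (setUC [set q]).
have nUp : ~ U p by move=> /Upq; apply; left.
have conq : connected (~` [set q]) by apply: contrapT; exact: noncut.
have [||z [zq [clUz nUz]]] := connected_boundary conq oU.
- by exists u; split => // uq; apply: (Upq _ Uu); right.
- by move=> /(_ p pq).
by have [//|[<-//|/zq]] := clU _ clUz.
Qed.

Definition cut_pair p q U V :=
  [/\ [/\ open U, connected U & U !=set0], [/\ open V, connected V & V !=set0],
      U `&` V = set0 & ~` [set p; q] = U `|` V].

Lemma cut_pairC p q U V : cut_pair p q U V -> cut_pair p q V U.
Proof. by move=> [hU hV UV0 UV]; split => //; [rewrite setIC|rewrite UV setUC]. Qed.

Lemma cut_pair_neq p q U V x : cut_pair p q U V -> U x -> x <> p /\ x <> q.
Proof.
move=> [_ _ _ UV] Ux; have : (U `|` V) x by left.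
by rewrite -UV => xpq; split => xE; apply: xpq; [left|right].
Qed.

Lemma cut_pair_closure p q U V : p <> q -> cut_pair p q U V ->
  closure U = U `|` [set p; q].
Proof.
move=> pq [[oU _ U0] [oV _ _] UV0 UV]; apply: closure_pair_boundary => //.
  by rewrite UV; exact: subsetUl.
move=> y clUy; have [|ypq] := pselect ([set p; q] y); first by right.
have [|Vy] : (U `|` V) y by rewrite -UV.
  by left.
have [z UVz] := clUy _ (open_nbhs_nbhs (conj oV Vy)).
by move: UVz; rewrite UV0.
Qed.

Lemma cut_pair_closureU p q U V : p <> q -> cut_pair p q U V ->
  closure U `|` closure V = setT.
Proof.
move=> pq UVpq; have [_ _ _ UV] := UVpq.
rewrite (cut_pair_closure pq UVpq) (cut_pair_closure pq (cut_pairC UVpq)).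
by rewrite -setUUl -UV setUC setUCr.
Qed.

Lemma cut_pair_closureI p q U V : p <> q -> cut_pair p q U V ->
  closure U `&` closure V = [set p; q].
Proof.
move=> pq UVpq; have [_ _ UV0 _] := UVpq.
rewrite (cut_pair_closure pq UVpq) (cut_pair_closure pq (cut_pairC UVpq)).
by rewrite -setUIl UV0 set0U.
Qed.

Lemma cut_pair_exists p q : p <> q -> exists U V, cut_pair p q U V.
Proof.
move=> pq.
have [a [b [nKa nKb nab]]] := not_connected_separates (noncut_not_connected_setC2 pq).
pose U := side [set p; q] a.
have oU : open U.
  by apply: open_side => //; apply: closedU; exact: closed_point.
have Ua : U a by exact: connected_component_refl.
have clU : closure U = U `|` [set p; q].
  apply: closure_pair_boundary => //; first by exists a.
    exact: side_subC.
  exact: closure_side.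
exists U, (~` closure U); split.
- by split => //; [exact: component_connected|exists a].
- split; first exact/closed_openC/closed_closure.
    apply/noncut_subcontinuum_connectedC/subcontinuum_closure; first by exists a.
    exact: component_connected.
  by exists b; rewrite clU => -[].
- by apply/disjoints_subset; rewrite setCK; exact: subset_closure.
- by rewrite clU (setCU U) setUIr setUCr setTI; apply/esym/setUidPr/side_subC.
Qed.

(* A cut pair [{x, v}] with [v] in [V] also separates [p] from [q]: otherwise one side
   of it, with [x] and [v] adjoined, would join [U] to [V] without meeting [p] or [q]. *)
Lemma cut_pair_crossing p q U V x v G H : p <> q -> cut_pair p q U V -> U x -> V v ->
  cut_pair x v G H -> G p -> H q.
Proof.
move=> pq UVpq Ux Vv GHxv Gp.
have [xp xq] := cut_pair_neq UVpq Ux.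
have [vp vq] := cut_pair_neq (cut_pairC UVpq) Vv.
have [[oU _ _] [oV _ _] UV0 UV] := UVpq; have [_ [_ cH _] GH0 GH] := GHxv.
have GnH := (disjoints_subset _ _).1 GH0.
have UnV := (disjoints_subset _ _).1 UV0.
have xv : x <> v by move=> xv; apply: (UnV _ Ux); rewrite xv.
have [Gq|//] : (G `|` H) q by rewrite -GH => -[|] /esym.
have clH := cut_pair_closure xv (cut_pairC GHxv).
have clHU : closure H `<=` U.
  apply: (connected_sub_open (connected_closure cH) oU oV).
  - rewrite -UV clH => z [Hz [|]zE|[->|->] []//].
      by apply: GnH Hz; rewrite zE.
    by apply: GnH Hz; rewrite zE.
  - by rewrite -setIA UV0 setI0.
  - by exists x; rewrite clH; split => //; right; left.
by exfalso; apply: (UnV _ _ Vv); apply: clHU; rewrite clH; right; right.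
Qed.

Lemma cut_pair_cut_arc p q U V : p <> q -> cut_pair p q U V -> cut_arc (closure U) p q.
Proof.
move=> pq UVpq; have [[oU cU _] [oV _ [v Vv]] UV0 UV] := UVpq.
have clU := cut_pair_closure pq UVpq.
split; [by split => //; rewrite clU; right; [left|right]|exact: closed_closure
  |exact: connected_closure|move=> x clUx xp xq].
have Ux : U x by move: clUx; rewrite clU => -[|[]].
have nclUv : ~ closure U v.
  by move=> /(_ V (open_nbhs_nbhs (conj oV Vv))); rewrite UV0 => -[].
have xv : x <> v by move=> xv; apply: nclUv; rewrite -xv.
have [vp vq] := cut_pair_neq (cut_pairC UVpq) Vv.
have [G [H [GHxv Gp]]] : exists G H, cut_pair x v G H /\ G p.
  have [G [H GH]] := cut_pair_exists xv.
  have [_ _ _ GHE] := GH.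
  have [Gp|Hp] : (G `|` H) p by rewrite -GHE => -[|] /esym.
    by exists G, H.
  by exists H, G; split => //; exact: cut_pairC.
have Hq := cut_pair_crossing pq UVpq Ux Vv GHxv Gp.
have [[oG _ _] [oH _ _] GH0 GH] := GHxv.
have GnH := (disjoints_subset _ _).1 GH0.
exists (closure U `\` H), (closure U `\` G); split.
- by apply: closedI; [exact: closed_closure|exact: open_closedC].
- by apply: closedI; [exact: closed_closure|exact: open_closedC].
- by rewrite -setDIr setIC GH0 setD0.
- rewrite -setDUr setUC -GH; apply/seteqP; split => [y [clUy /contrapT[//|yv]]|_ ->].
    by exfalso; apply: nclUv; rewrite -yv.
  by split => //; apply; left.
- rewrite clU; split; split; [by right; left|exact: GnH|by right; right|].
  by move=> /GnH.
Qed.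

End NoCutPoint.

Section CutOrder.
Context {T : topologicalType}.
Implicit Types (A C D E : set T) (p q x y z u : T).

Lemma cuts_atC A p q x D E : cuts_at A p q x D E -> cuts_at A q p x E D.
Proof. by move=> [cD cE ADE DEx [Dp Eq]]; split; rewrite 1?setUC 1?setIC. Qed.

(* [D] is the image of [A] under the retraction collapsing [E] to [x]. *)
Lemma cuts_at_connected A p q x D E : connected A -> cuts_at A p q x D E ->
  connected D.
Proof.
move=> cA [cD cE ADE DEx _].
have Dx : D x by have [] : (D `&` E) x by rewrite DEx.
pose r := patch (cst x) D id.
have rD y : D y -> r y = y by move=> Dy; apply: patchT; exact/mem_set.
have rE y : E y -> r y = x.
  move=> Ey; have [Dy|nDy] := pselect (D y); last first.
    by rewrite /r patchC//; exact/mem_set.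
  by rewrite rD//; have : (D `&` E) y by []; rewrite DEx.
have -> : D = r @` A.
  apply/seteqP; split => [y Dy|_ [y + <-]].
    by exists y; [rewrite ADE; left|exact: rD].
  by rewrite ADE => -[Dy|Ey]; [rewrite rD|rewrite rE].
apply: connected_continuous_connected => //; rewrite ADE.
apply: withinU_continuous => //.
  have cid : {within D, continuous id} by apply: continuous_subspaceT => y; exact: cvg_id.
  by apply: subspace_eq_continuous cid => y /set_mem Dy; rewrite /from_subspace rD.
have cx : {within E, continuous (cst x)} by exact/continuous_subspaceT/cst_continuous.
by apply: subspace_eq_continuous cx => y /set_mem Ey; rewrite /from_subspace rE.
Qed.

(* For an arc from [p] to [q], [init x] and [final x] are the subarcs from [p] to [x]
   and from [x] to [q]; thus [init y x] says that [x] comes before [y]. *)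
Definition cut_family A p q (init final : T -> set T) :=
  connected A /\ forall x, A x -> cuts_at A p q x (init x) (final x).

Lemma cut_familyC A p q init final : cut_family A p q init final ->
  cut_family A q p final init.
Proof. by move=> [cA cuts]; split => // x /cuts/cuts_atC. Qed.

Lemma cut_arc_family A p q : hausdorff_space T -> cut_arc A p q ->
  exists init final, cut_family A p q init final.
Proof.
move=> hT [[pq Ap Aq] cA conA cuts].
have /choice[DE DEP] : forall x, exists DE : set T * set T,
    A x -> cuts_at A p q x DE.1 DE.2.
  move=> x; have [Ax|nAx] := pselect (A x); last by exists (set0, set0).
  have [->|xp] := pselect (x = p).
    exists ([set p], A); split => //; first exact: closed_point.
      by apply/esym/setUidPr => _ ->.
    by apply/setIidPl => _ ->.
  have [->|xq] := pselect (x = q).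
    exists (A, [set q]); split => //; first exact: closed_point.
      by apply/esym/setUidPl => _ ->.
    by apply/setIidPr => _ ->.
  by have [D [E DE]] := cuts _ Ax xp xq; exists (D, E).
by exists (fun x => (DE x).1), (fun x => (DE x).2); split.
Qed.

Section CutFamily.
Context (A : set T) (p q : T) (init final : T -> set T).
Context (cutA : cut_family A p q init final).

Lemma init_self x : A x -> init x x.
Proof.
by move=> /cutA.2[_ _ _ DEx _]; have [] : (init x `&` final x) x by rewrite DEx.
Qed.

Lemma init_final_eq x z : A x -> init x z -> final x z -> z = x.
Proof.
by move=> /cutA.2[_ _ _ DEx _] Dz Ez; have : (init x `&` final x) z by []; rewrite DEx.
Qed.

Lemma init_sub x : A x -> init x `<=` A.
Proof. by move=> /cutA.2[_ _ -> _ _]; exact: subsetUl. Qed.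

Lemma init_or_final x z : A x -> A z -> init x z \/ final x z.
Proof. by move=> /cutA.2[_ _ {1}-> _ _]. Qed.

Lemma closed_init x : A x -> closed (init x).
Proof. by move=> /cutA.2[]. Qed.

Lemma connected_init x : A x -> connected (init x).
Proof. by move=> /cutA.2; apply: cuts_at_connected; exact: cutA.1. Qed.

Lemma init_left x : A x -> init x p.
Proof. by move=> /cutA.2[_ _ _ _ []]. Qed.

Lemma connected_sub_init C y : A y -> connected C -> C `<=` A -> ~ C y ->
  C `&` init y !=set0 -> C `<=` init y.
Proof.
move=> /cutA.2[cD cE ADE DEy _] cC CA nCy.
apply: (connected_sub_closed cC cD cE); first by rewrite -ADE.
by rewrite -setIA DEy -subset0 => z [Cz zy]; apply: nCy; rewrite -zy.
Qed.

End CutFamily.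

Section CutFamilyOrder.
Context (A : set T) (p q : T) (init final : T -> set T).

Lemma final_subset x y : cut_family A p q init final -> A x -> init x y ->
  final x `<=` final y.
Proof.
move=> cutA Ax xy; have cutAC := cut_familyC cutA; have Ay := init_sub cutA Ax xy.
have [->//|yx] := pselect (y = x).
apply: (connected_sub_init cutAC Ay).
- exact: (connected_init cutAC).
- exact: (init_sub cutAC).
- by move=> fxy; apply: yx; exact: (init_final_eq cutA Ax xy fxy).
- by exists q; split; exact: (init_left cutAC).
Qed.

Lemma final_init x y : cut_family A p q init final -> A x -> init x y -> final y x.
Proof.
move=> cutA Ax xy; apply: (final_subset cutA Ax xy).
exact: (init_self (cut_familyC cutA)).
Qed.

End CutFamilyOrder.

Section CutFamilyTheory.
Context (A : set T) (p q : T) (init final : T -> set T).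
Context (cutA : cut_family A p q init final).
Let cutAC := cut_familyC cutA.

Lemma init_final x y : A x -> final x y -> init y x.
Proof. exact: (final_init cutAC). Qed.

Lemma init_subset x y : A x -> init x y -> init y `<=` init x.
Proof.
move=> Ax xy; have Ay := init_sub cutA Ax xy.
by apply: (final_subset cutAC Ay); exact: (final_init cutA).
Qed.

Lemma init_anti x y : A x -> A y -> init x y -> init y x -> x = y.
Proof.
by move=> Ax Ay xy yx; apply: (init_final_eq cutA Ay yx); exact: (final_init cutA).
Qed.

Lemma cut_family_dense x w : A x -> final x w -> w <> x ->
  exists z, [/\ final x z, z <> x & ~ init z w].
Proof.
move=> Ax xw wx; apply: contrapT => nodense.
have Aw := init_sub cutAC Ax xw.
have nxw : ~ init x w by move=> /(init_final_eq cutA Ax)/(_ xw).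
suff : init w `<=` init x by move=> /(_ w (init_self cutA Aw)).
have cw : closed [set w].
  suff -> : [set w] = init w `&` final w.
    by apply: closedI; [exact: (closed_init cutA)|exact: (closed_init cutAC)].
  by have [_ _ _ -> _] := cutA.2 _ Aw.
apply: (connected_sub_closed (connected_init cutA Aw) (closed_init cutA Ax) cw).
- move=> z wz; have [xz|xz] := init_or_final cutA Ax (init_sub cutA Aw wz); first by left.
  have [->|zx] := pselect (z = x); first by left; exact: (init_self cutA).
  right; apply: contrapT => zw; apply: nodense; exists z; split => // zw'.
  by apply: zw; apply: init_anti => //; exact: (init_sub cutA Aw).
- by rewrite -subset0 => z [[_ xz] zw]; apply: nxw; rewrite -zw.
- by exists p; split; exact: (init_left cutA).
Qed.

End CutFamilyTheory.

Lemma final_init_near A p q init final x O : compact [set: T] ->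
  cut_family A p q init final -> A x -> open O -> O x ->
  \forall u \near x, A u -> final x `&` init u `<=` O.
Proof.
move=> cpt cutA Ax oO Ox; have cutAC := cut_familyC cutA.
have [xq|xq] := pselect (x = q).
  apply: nearW => u Au z [xz uz]; suff -> : z = x by [].
  have Az := init_sub cutA Au uz; apply: (init_anti cutA Az Ax).
    exact: (init_final cutA).
  by rewrite xq; apply: (init_final cutA Az); exact: (init_left cutAC).
pose beyond := [set z | final x z /\ z <> x].
have beyondA z : beyond z -> A z by move=> [/(init_sub cutAC Ax)].
have xlq : final x q by exact: (init_left cutAC).
have [|z z' bz bz'|z [xz _]|w nOw|z bz zO] := compact_directed_cover
    (D := beyond) (U := fun z => ~` (final x `&` init z))
    (subclosed_compact (open_closedC oO) cpt (@subsetT _ (~` O))).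
- by exists q; split => //; exact: nesym.
- have anti y y' : init y `<=` init y' ->
      ~` (final x `&` init y') `<=` ~` (final x `&` init y).
    by move=> yy'; apply: subsetC; exact: setIS.
  have [zz'|zz'] := init_or_final cutA (beyondA _ bz) (beyondA _ bz').
    exists z' => //; rewrite subUset; split => //; apply: anti.
    by apply: (init_subset cutA _ zz'); exact: beyondA.
  exists z => //; rewrite subUset; split => //; apply: anti.
  apply: (init_subset cutA (beyondA _ bz')).
  by apply: (init_final cutA _ zz'); exact: beyondA.
- apply: closed_openC; apply: closedI; [exact: (closed_init cutAC)|].
  by apply: (closed_init cutA); exact: (init_sub cutAC Ax).
- have [xw|nxw] := pselect (final x w); last first.
    by exists q; [split => //; exact: nesym|case].
  have wx : w <> x by move=> wx; apply: nOw; rewrite wx.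
  have [z [xz zx nzw]] := cut_family_dense cutA Ax xw wx.
  by exists z => // -[].
have Az := beyondA _ bz; have [xz zx] := bz.
have nzx : ~ final z x.
  by move=> /(init_final cutA Az) xz'; apply: zx; exact: (init_final_eq cutA Ax).
apply: (filterS _ (open_nbhs_nbhs (conj (closed_openC (closed_init cutAC Az)) nzx))).
move=> u nzu Au y [xy uy]; apply: contrapT => nOy; apply: (zO _ nOy); split => //.
have [zu|//] := init_or_final cutA Az Au.
exact: (init_subset cutA Az zu).
Qed.

End CutOrder.

Section TruncatedDistance.
Context {R : realType} {X : pseudoMetricType R}.
Implicit Types (K L : set X) (c y z : X) (e : R).

Definition trunc_dist K c : R := fine (mine (edist_inf K c) 1%E).

Lemma trunc_distE K c : (trunc_dist K c)%:E = mine (edist_inf K c) 1%E.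
Proof.
rewrite /trunc_dist fineK// ge0_fin_numE; first by rewrite gt_min ltry orbT.
by rewrite le_min edist_inf_ge0 lee01.
Qed.

Lemma trunc_dist_ge0 K c : 0 <= trunc_dist K c.
Proof. by rewrite -lee_fin trunc_distE le_min edist_inf_ge0 lee01. Qed.

Lemma trunc_dist_le1 K c : trunc_dist K c <= 1.
Proof. by rewrite -lee_fin trunc_distE ge_min lexx orbT. Qed.

Lemma trunc_dist_anti K L c : K `<=` L -> trunc_dist L c <= trunc_dist K c.
Proof.
move=> KL; rewrite -lee_fin !trunc_distE le_min !ge_min lexx orbT andbT.
by rewrite ereal_inf_le_tmp//; exact: image_subset.
Qed.

Lemma trunc_dist_lipschitz K L c e : 0 < e ->
  (forall z, L z -> exists2 y, K y & ball y e z) ->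
  trunc_dist K c <= trunc_dist L c + e.
Proof.
move=> e0 LK; rewrite -lee_fin EFinD !trunc_distE.
have KL : (edist_inf K c <= edist_inf L c + e%:E)%E.
  rewrite -leeBlDr//; apply: le_ereal_inf_tmp => _ [z /LK[y Ky yez] <-].
  rewrite leeBlDr//; apply: (@le_trans _ _ (edist (c, y))).
    by apply: ereal_inf_lbound; exists y.
  apply: (le_trans (edist_triangle c z y)); rewrite leeD2l//.
  by apply: edist_fin => //; exact: ball_sym.
rewrite ge_min; have [_|_] := leP (edist_inf L c) 1%E; first by rewrite KL.
by rewrite leeDl ?orbT// lee_fin ltW.
Qed.

Lemma trunc_dist_separates K L y : closed K -> ~ K y -> L y ->
  exists2 e, 0 < e & forall c, ball c e y -> trunc_dist L c < trunc_dist K c.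
Proof.
move=> cK nKy Ly.
have /nbhs_ballP[d d0 yd] : nbhs y (~` K).
  by apply: open_nbhs_nbhs; split => //; exact: closed_openC.
pose e := Num.min d 1 / 3.
have e0 : 0 < e by rewrite divr_gt0// lt_min d0 ltr01.
have [mind min1] : Num.min d 1 <= d /\ Num.min d 1 <= 1 by rewrite !ge_min !lexx orbT.
have e3 : e + 2 * e <= d by rewrite /e; lra.
have e1 : 2 * e <= 1 by rewrite /e; lra.
exists e => // c cy; apply: (@le_lt_trans _ _ e).
  rewrite -lee_fin trunc_distE ge_min (le_trans _ (@edist_fin _ _ _ (c, y) e0 cy))//.
  by apply: ereal_inf_lbound; exists y.
apply: (@lt_le_trans _ _ (2 * e)); first by lra.
rewrite -lee_fin trunc_distE le_min lee_fin e1 andbT.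
apply: le_ereal_inf_tmp => _ [z Kz <-]; rewrite leNgt; apply/negP => /edist_lt_ball cz.
apply: (yd z) Kz; apply: (le_ball e3).
exact: ball_triangle (ball_sym cy) cz.
Qed.

End TruncatedDistance.

Lemma compact_dense_sequence {R : realType} {X : pseudoMetricType R} (x0 : X) :
  compact [set: X] -> exists c : nat -> X,
    forall x e, 0 < e -> exists n, ball (c n) e x.
Proof.
move=> cpt; pose U n (s : seq X) := \bigcup_(c in [set` s]) (ball c (n.+1%:R^-1 : R))°.
have [net netP] : {net : nat -> seq X & forall n, [set: X] `<=` U n (net n)}.
  apply: (@choice _ _ (fun n s => [set: X] `<=` U n s)) => n.
  have [|s t _ _|s _|x _|s _ sT] := @compact_directed_cover _ _ setT (U n) _ cpt.
  - by exists [::].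
  - by exists (s ++ t) => // x [] [c /= cs cx]; exists c => //=; rewrite mem_cat cs ?orbT.
  - by apply: bigcup_open => c _; exact: open_interior.
  - exists [:: x] => //; exists x; first by rewrite /= inE.
    by apply: nbhsx_ballx; rewrite invr_gt0.
  - by exists s.
exists (fun k => if unpickle k is Some (n, i) then nth x0 (net n) i else x0).
move=> x e e0; have [n _ /(_ n (leqnn n)) /= ne] := near_infty_natSinv_lt (PosNum e0).
have [c /= cn cx] := netP n x I.
exists (pickle (n, index c (net n))); rewrite pickleK nth_index//.
exact: le_ball (ltW ne) _ (interior_subset cx).
Qed.

Section SeriesOfFunctions.
Context {R : realType}.

Lemma lt_lim_series (u v : R^nat) n : cvgn (series u) -> cvgn (series v) ->
  (forall k, u k <= v k) -> u n < v n -> limn (series u) < limn (series v).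
Proof.
move=> cu cv uv uvn; rewrite -subr_gt0 -lim_seriesB//.
have cw : cvgn (series (v - u)) by exact: is_cvg_seriesB.
have w0 k : 0 <= (v - u) k by rewrite subr_ge0.
apply: (@lt_le_trans _ _ (series (v - u) n.+1)).
  rewrite /series/= big_nat_recr//= ltr_wpDl ?subr_gt0//.
  by apply: sumr_ge0 => k _; exact: w0.
by apply: nondecreasing_cvgn_le => //; apply: nondecreasing_series => k _ _; exact: w0.
Qed.

Lemma weierstrass_M_test_cvg {T : Type} (u : nat -> T -> R) (M : R^nat) :
  (forall n x, `|u n x| <= M n) -> cvgn (series M) ->
  forall x, cvgn (series (u ^~ x)).
Proof.
move=> uM cM x; apply: normed_cvg; apply: series_le_cvg cM => n //=.
exact: le_trans (uM n x).
Qed.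

Lemma weierstrass_M_test_continuous {T : topologicalType} (u : nat -> T -> R)
    (M : R^nat) : (forall n, continuous (u n)) -> (forall n x, `|u n x| <= M n) ->
  cvgn (series M) -> continuous (fun x => limn (series (u ^~ x))).
Proof.
move=> cu uM cM x; have cs := weierstrass_M_test_cvg uM cM.
have tail N y : `|limn (series (u ^~ y)) - series (u ^~ y) N| <=
    limn (series M) - series M N.
  have M0 n : 0 <= M n by exact: le_trans (uM n y).
  have cSN : `|series (u ^~ y) n - series (u ^~ y) N| @[n --> \oo] -->
      `|limn (series (u ^~ y)) - series (u ^~ y) N|.
    by apply: cvg_norm; apply: cvgB; [exact: cs|exact: cvg_cst].
  apply: (cvgr_to_le cSN); exists N => // n /= Nn.
  apply: (@le_trans _ _ (series M n - series M N)).
    by rewrite !sub_series Nn; apply: le_trans (ler_norm_sum _ _ _) (ler_sum _ _).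
  rewrite lerD2r; apply: nondecreasing_cvgn_le => //.
  by apply: nondecreasing_series => k _ _; exact: M0.
apply/cvgrPdist_lt => e e0; have e30 : 0 < e / 3 by rewrite divr_gt0.
have [N _ /(_ N (leqnn N))/= MN] := (cvgrPdist_lt _ _).1 cM _ e30.
have : series (u ^~ y) N @[y --> x] --> series (u ^~ x) N.
  by apply: cvg_big => [|n _]; [exact: add_continuous|exact: cu].
move=> /cvgrPdist_lt/(_ _ e30); apply: filterS => y.
have := tail N x; have := tail N y; have := ler_norm (limn (series M) - series M N).
rewrite !ler_norml !ltr_norml => ? /andP[? ?] /andP[? ?] /andP[? ?].
by apply/andP; split; lra.
Qed.

End SeriesOfFunctions.

Section Parametrization.
Context {R : realType} {X : pseudoMetricType R} (cpt : compact [set: X]).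
Context (A : set X) (p q : X).

Section CutFamilyParametrization.
Context (init final : X -> set X) (cutA : cut_family A p q init final).
Let cutAC := cut_familyC cutA.

Lemma init_ball_near x e : A x -> 0 < e -> \forall u \near x, A u ->
  (forall z, init u z -> exists2 y, init x y & ball y e z) /\
  (forall z, init x z -> exists2 y, init u y & ball y e z).
Proof.
move=> Ax e0; have e20 : 0 < e / 2 by rewrite divr_gt0.
have Ox : (ball x (e / 2))° x by exact: nbhsx_ballx.
have near_final := final_init_near cpt cutA Ax (@open_interior _ _) Ox.
have near_init := final_init_near cpt cutAC Ax (@open_interior _ _) Ox.
apply: (@filterS _ (nbhs x)) (filterI near_final near_init) => u [+ +] Au.
move=> /= /(_ Au) xu /(_ Au) ux; have uu := init_self cutA Au; split => z.
  move=> uz; have Az := init_sub cutA Au uz.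
  have [xz|xz] := init_or_final cutA Ax Az; first by exists z => //; exact: ballxx.
  exists x; first exact: (init_self cutA).
  apply: (@le_ball _ _ _ (e / 2)); first by lra.
  by apply: interior_subset; exact: xu.
move=> xz; have Az := init_sub cutA Ax xz.
have [uz|uz] := init_or_final cutA Au Az; first by exists z => //; exact: ballxx.
have [xlu|xlu] := init_or_final cutA Ax Au; last first.
  exists z; last exact: ballxx.
  by apply: (init_subset cutA Au) xz; exact: (init_final cutA).
exists u => //; rewrite (splitr e); apply: (@ball_triangle _ _ x).
  apply: ball_sym; apply: interior_subset; apply: ux; split => //.
  exact: (init_self cutAC).
by apply: interior_subset; exact: ux.
Qed.

Lemma trunc_dist_init_continuous c :
  {within A, continuous (fun x => trunc_dist (init x) c)}.
Proof.
apply/subspace_continuousP => x Ax; apply/cvgrPdist_le => e e0.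
apply: (@filterS _ (nbhs x)) (init_ball_near Ax e0) => u + Au => /(_ Au)[ux xu].
have := trunc_dist_lipschitz c e0 ux; have := trunc_dist_lipschitz c e0 xu.
by rewrite /from_subspace ler_norml => ? ?; apply/andP; split; lra.
Qed.

Lemma cut_family_decreasing_function : exists h : X -> R,
  {within A, continuous h} /\
  forall x y, A x -> A y -> init y x -> x <> y -> h y < h x.
Proof.
have [c cP] := compact_dense_sequence p cpt.
pose u n x : R := trunc_dist (init x) (c n) * 2^-1 ^+ n.
pose M : R^nat := geometric 1 2^-1.
have cM : cvgn (series M).
  by apply: is_cvg_geometric_series; rewrite ger0_norm//; lra.
have pow0 n : 0 < 2^-1 ^+ n :> R by rewrite exprn_gt0.
have uM n x : `|u n x| <= M n.
  rewrite ger0_norm; first by rewrite ler_wpM2r ?trunc_dist_le1// ltW.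
  by rewrite mulr_ge0 ?trunc_dist_ge0// ltW.
exists (fun x => limn (series (u ^~ x))); split.
  apply: (@weierstrass_M_test_continuous _ (subspace A) u M) => // n.
  apply/subspace_continuousP => x Ax; apply: cvgM; last exact: cvg_cst.
  exact: (subspace_continuousP _ _).1 (@trunc_dist_init_continuous (c n)) x Ax.
move=> x y Ax Ay yx xy.
have nxy : ~ init x y by move=> lxy; apply: xy; exact: (init_anti cutA).
have [e e0 eP] := trunc_dist_separates (closed_init cutA Ax) nxy (init_self cutA Ay).
have [n cn] := cP y e e0.
have cs := weierstrass_M_test_cvg uM cM.
apply: (@lt_lim_series _ _ _ n) => // [k|]; last by rewrite ltr_pM2r//; exact: eP.
by rewrite ler_pM2r//; apply/trunc_dist_anti/(init_subset cutA).
Qed.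

End CutFamilyParametrization.

Lemma cut_arc_parametrization (a b : R) : hausdorff_space X -> a < b ->
  cut_arc A p q -> exists h : X -> R,
  [/\ {within A, continuous h}, set_bij A `[a, b] h, h p = a & h q = b].
Proof.
move=> hX ab /[dup] arcA [[pq Ap Aq] _ conA _].
have [init [final cutA]] := cut_arc_family hX arcA.
have [k [ck k_lt]] := cut_family_decreasing_function cutA.
have qp : init q p by exact: (init_left cutA).
have kqp : 0 < k p - k q by rewrite subr_gt0; exact: k_lt.
pose h x := a + (b - a) / (k p - k q) * (k p - k x).
have hp : h p = a by rewrite /h subrr mulr0 addr0.
have hq : h q = b by rewrite /h divfK ?lt0r_neq0// addrC subrK.
have h_lt x y : A x -> A y -> init y x -> x <> y -> h x < h y.
  move=> Ax Ay yx xy; rewrite /h ltrD2l ltr_pM2l; first by rewrite ltrD2l ltrN2 k_lt.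
  by rewrite divr_gt0// subr_gt0.
have ch : {within A, continuous h}.
  apply/subspace_continuousP => x Ax; apply: cvgD; first exact: cvg_cst.
  apply: cvgM; first exact: cvg_cst.
  by apply: cvgB; [exact: cvg_cst|exact: (subspace_continuousP _ _).1 ck x Ax].
have hA x : A x -> h x \in `[a, b].
  move=> Ax; rewrite in_itv/=; apply/andP; split.
    have [<-|px] := pselect (p = x); first by rewrite hp.
    by rewrite -hp ltW// h_lt//; exact: (init_left cutA).
  have [->|xq] := pselect (x = q); first by rewrite hq.
  rewrite -hq ltW// h_lt//; apply: (init_final cutA Ax).
  exact: (init_left (cut_familyC cutA)).
have h_inj x y : A x -> A y -> h x = h y -> x = y.
  move=> Ax Ay hxy; apply: contrapT => xy.
  have [xly|/(init_final cutA Ax) yx] := init_or_final cutA Ax Ay.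
    by have := h_lt _ _ Ay Ax xly (nesym xy); rewrite hxy ltxx.
  by have := h_lt _ _ Ax Ay yx xy; rewrite hxy ltxx.
have hA_itv : is_interval (h @` A).
  by apply/connected_intervalP; exact: connected_continuous_connected.
exists h; split => //; split => [x Ax|x y|r].
- exact: hA.
- by move=> /set_mem Ax /set_mem Ay; exact: h_inj.
- by rewrite /= in_itv/=; apply: hA_itv; [exists p|exists q].
Qed.

End Parametrization.

Section CompactBijections.
Context {T U : topologicalType}.

Lemma compact_inverse_continuous (g : T -> U) (f : U -> T) :
  compact [set: T] -> hausdorff_space U -> continuous g -> cancel g f ->
  {within range g, continuous f}.
Proof.
move=> cT hU cg fg; apply/subspace_continuousP => _ [x _ <-].
rewrite /from_subspace fg => W; rewrite nbhsE => -[N [oN Nx] NW].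
have cK : closed (g @` (~` N)).
  apply: compact_closed => //; apply: continuous_compact.
    exact: continuous_subspaceT.
  exact: (subclosed_compact (open_closedC oN) cT).
apply: (@filterS _ (nbhs (g x)) _ (~` (g @` (~` N)))).
  move=> y nKy [z _ gz]; apply: NW; rewrite -gz fg; apply: contrapT => nNz.
  by apply: nKy; exists z.
apply: open_nbhs_nbhs; split; first exact: closed_openC.
by move=> [z nNz gzx]; apply: nNz; rewrite -(fg z) gzx fg.
Qed.

Lemma compact_bij_inverse (B : set U) (g : T -> U) : [set: T] !=set0 ->
  compact [set: T] -> hausdorff_space U -> continuous g -> set_bij setT B g ->
  exists f : U -> T, [/\ {within B, continuous f}, cancel g f & {in B, cancel f g}].
Proof.
move=> [t0 _] cT hU cg [gB g_inj g_surj]; pose f := 'pinv_(fun=> t0) setT g.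
have fg : cancel g f by move=> x; apply: pinvKV => //; rewrite inE.
have BE : B = range g by apply/seteqP; split => // _ [x _ <-]; exact: gB.
exists f; split => //; first by rewrite BE; exact: compact_inverse_continuous.
by move=> _ /set_mem/g_surj[x _ <-]; rewrite fg.
Qed.

Lemma patch_continuous (A B : set T) (f g : T -> U) : closed A -> closed B ->
  A `|` B = setT -> (forall x, A x -> B x -> f x = g x) ->
  {within A, continuous f} -> {within B, continuous g} -> continuous (patch g A f).
Proof.
move=> cA cB ABT fg cf cg; apply/continuous_subspace_setT.
rewrite -ABT; apply: withinU_continuous => //.
  by apply: subspace_eq_continuous cf => x Ax; rewrite /from_subspace patchT.
apply: subspace_eq_continuous cg => x /set_mem Bx; rewrite /from_subspace.
by have [Ax|nAx] := pselect (A x); [rewrite patchT ?fg//|rewrite patchC//]; exact/mem_set.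
Qed.

End CompactBijections.

Section Semicircles.
Context {R : realType}.
Implicit Types (s t u : R).

Definition semicircle s t : R * R := (t, s * Num.sqrt (1 - t ^+ 2)).

Lemma semicircle_continuous s : continuous (semicircle s).
Proof.
move=> t; have ct : s * Num.sqrt (1 - u ^+ 2) @[u --> t] --> s * Num.sqrt (1 - t ^+ 2).
  apply: cvgM; first exact: cvg_cst.
  apply: (@continuous_comp _ _ _ (fun t : R => 1 - t ^+ 2)); last exact: sqrt_continuous.
  by apply: cvgB; [exact: cvg_cst|exact: exprn_continuous].
exact: cvg_pair cvg_id ct.
Qed.

Lemma semicircle_unit_circle s t : s ^+ 2 = 1 -> t \in `[-1, 1] ->
  unit_circle (semicircle s t).
Proof.
move=> s1 /[!in_itv]/= /andP[t0 t1]; rewrite /unit_circle/= exprMn s1 mul1r sqr_sqrtr.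
  by rewrite addrC subrK.
by nra.
Qed.

Lemma semicircle_end s t : t ^+ 2 = 1 -> semicircle s t = (t, 0).
Proof. by move=> t1; rewrite /semicircle t1 subrr sqrtr0 mulr0. Qed.

Lemma semicircle_meet t u : t \in `[-1, 1] -> semicircle 1 t = semicircle (- 1) u ->
  t = u /\ (t = - 1 \/ t = 1).
Proof.
move=> /[!in_itv]/= /andP[t0 t1] [<-]; rewrite mul1r mulN1r => sqrtN; split => //.
have /eqP : Num.sqrt (1 - t ^+ 2) = 0 by have := sqrtr_ge0 (1 - t ^+ 2); lra.
rewrite sqrtr_eq0 => ht; have /eqP : t ^+ 2 = 1 by apply/eqP; rewrite eq_le; nra.
by rewrite sqrf_eq1 => /orP[/eqP|/eqP]; [right|left].
Qed.

Lemma unit_circle_semicircle (v : R * R) : unit_circle v ->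
  v.1 \in `[-1, 1] /\ (v = semicircle 1 v.1 \/ v = semicircle (- 1) v.1).
Proof.
case: v => a b; rewrite /unit_circle/= => ab; split.
  by rewrite in_itv/=; apply/andP; split; nra.
have sqrtb : Num.sqrt (1 - a ^+ 2) = `|b| by rewrite -ab addrC addKr sqrtr_sqr.
rewrite /semicircle sqrtb mul1r mulN1r.
have [b0|b0] := leP 0 b; first by left; rewrite ger0_norm.
by right; rewrite ltr0_norm// opprK.
Qed.

Lemma semicircles_bij {X : Type} (A B : set X) (h k : X -> R) :
  A `|` B = setT -> set_bij A `[-1, 1] h -> set_bij B `[-1, 1] k ->
  (forall x, A x -> B x -> semicircle 1 (h x) = semicircle (- 1) (k x)) ->
  (forall t, t = - 1 \/ t = 1 -> exists e, [/\ A e, B e, h e = t & k e = t]) ->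
  set_bij setT unit_circle (patch (semicircle (- 1) \o k) A (semicircle 1 \o h)).
Proof.
move=> ABT [hA h_inj h_surj] [kB k_inj k_surj] hk ends; set g := patch _ _ _.
have gA x : A x -> g x = semicircle 1 (h x) by move=> Ax; apply: patchT; exact/mem_set.
have gB x : B x -> g x = semicircle (- 1) (k x).
  move=> Bx; have [Ax|nAx] := pselect (A x); first by rewrite gA// hk.
  by apply: patchC; exact/mem_set.
have AorB x : A x \/ B x by have : (A `|` B) x by rewrite ABT.
have meet x y : A x -> B y -> g x = g y -> x = y.
  move=> Ax By; rewrite gA// gB// => /(semicircle_meet (hA _ Ax))[hxky].
  move=> /ends[e [Ae Be he ke]].
  have -> : x = e by apply: h_inj => //; exact/mem_set.
  by apply/esym; apply: k_inj; rewrite -?hxky//; exact/mem_set.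
split=> [x _|x y _ _|v].
- have [Ax|Bx] := AorB x; [rewrite gA//|rewrite gB//]; apply: semicircle_unit_circle;
    by [rewrite ?sqrrN expr1n|exact: hA|exact: kB].
- have [Ax|Bx] := AorB x; have [Ay|By] := AorB y; [|exact: meet| |].
  + by rewrite !gA// => -[hxy _]; apply: h_inj => //; exact/mem_set.
  + by move=> /esym; move/meet => ->.
  + by rewrite !gB// => -[kxy _]; apply: k_inj => //; exact/mem_set.
- move=> /unit_circle_semicircle[v1 [->|->]].
    by have [x Ax <-] := h_surj _ v1; exists x => //; rewrite gA.
  by have [x Bx <-] := k_surj _ v1; exists x => //; rewrite gB.
Qed.

End Semicircles.

Section ArcsAndCircles.
Context {R : realType} {X : pseudoMetricType R}.
Context (hX : hausdorff_space X) (cpt : compact [set: X]).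

Lemma cut_arc_is_arc (p q : X) : cut_arc [set: X] p q -> @is_arc R X.
Proof.
move=> arcX; have [g [cg gbij _ _]] := cut_arc_parametrization cpt hX ltr01 arcX.
have {}cg : continuous g by exact/continuous_subspace_setT.
have X0 : [set: X] !=set0 by exists p.
have [f [cf fg gf]] := compact_bij_inverse X0 cpt (@norm_hausdorff R R) cg gbij.
have [g01 _ _] := gbij.
by exists f, g; split => // [x|t t01]; [exact: g01|apply: gf; exact/mem_set].
Qed.

Lemma two_cut_arcs_is_simple_closed_curve (A B : set X) (p q : X) :
  A `|` B = setT -> A `&` B = [set p; q] -> cut_arc A p q -> cut_arc B p q ->
  @is_simple_closed_curve R X.
Proof.
move=> ABT ABpq arcA arcB.
have ltN11 : -1 < 1 :> R by lra.
have [h [ch h_bij hp hq]] := cut_arc_parametrization cpt hX ltN11 arcA.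
have [k [ck k_bij kp kq]] := cut_arc_parametrization cpt hX ltN11 arcB.
have [[_ Ap Aq] cA _ _] := arcA; have [[_ Bp Bq] cB _ _] := arcB.
have hk x : A x -> B x -> semicircle 1 (h x) = semicircle (- 1) (k x).
  move=> Ax Bx; have [->|->] : [set p; q] x by rewrite -ABpq.
    by rewrite hp kp !semicircle_end ?sqrrN ?expr1n.
  by rewrite hq kq !semicircle_end ?expr1n.
pose g := patch (semicircle (- 1) \o k) A (semicircle 1 \o h).
have cg : continuous g.
  apply: (patch_continuous cA cB ABT hk) => x.
    exact: (continuous_comp (ch x) (@semicircle_continuous R 1 _)).
  exact: (continuous_comp (ck x) (@semicircle_continuous R (- 1) _)).
have g_bij : set_bij setT unit_circle g.
  by apply: (semicircles_bij (B := B)) => // t [->|->]; [exists p|exists q].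
have X0 : [set: X] !=set0 by exists p.
have [f [cf fg gf]] :=
  compact_bij_inverse X0 cpt (@norm_hausdorff R (R * R)%type) cg g_bij.
have [gS _ _] := g_bij.
by exists f, g; split => // [x|v Sv]; [exact: gS|apply: gf; exact/mem_set].
Qed.

End ArcsAndCircles.

Theorem theorem1 (R : realType) (X : pseudoMetricType R)
  (hX : hausdorff_space X)
  (cpt : compact [set: X]) (conn : connected [set: X])
  (nontriv : exists x y : X, x <> y)
  (lc : @locally_connected_space X)
  (hcl : closed_in_CX (@NCstar X)) :
  @is_arc R X \/ @is_simple_closed_curve R X.
Proof.
have [[c cutc]|noncut] := pselect (exists c : X, cut_point c).
  left; have [p [q arcX]] := cut_point_cut_arc hX cpt conn lc hcl cutc.
  exact: (cut_arc_is_arc hX cpt arcX).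
have {}noncut (x : X) : ~ cut_point x by move=> cutx; apply: noncut; exists x.
right; have [p [q pq]] := nontriv.
have [U [V UV]] := cut_pair_exists hX cpt conn lc hcl noncut pq.
apply: (two_cut_arcs_is_simple_closed_curve hX cpt (A := closure U) (B := closure V)).
- exact: (cut_pair_closureU noncut pq UV).
- exact: (cut_pair_closureI noncut pq UV).
- exact: (cut_pair_cut_arc hX cpt conn lc hcl noncut pq UV).
- exact: (cut_pair_cut_arc hX cpt conn lc hcl noncut pq (cut_pairC UV)).
Qed.
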